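(* Let $(E,\|\cdot\|)$ be a complex normed vector space. Let $\mathcal G_{\|\cdot\|}(E)$ be the set of norm-closed vector subspaces of $E$, and let $\mathcal G_{w*}(E^* )$ be the set of weak-$*$ closed vector subspaces of the dual $E^*$. The map $$\Phi:\mathcal G_{\|\cdot\|}(E)\to\mathcal G_{w*}(E^* ),\qquad V\mapsto V^\perp:=\{\omega\in E^*:\ \forall x\in V,\ \omega(x)=0\}$$ is a homeomorphism if $\mathcal G_{\|\cdot\|}(E)$ is endowed with the Wijsman topology and $\mathcal G_{w*}(E^* )$ is endowed with the Vietoris topology.
   Context: Wijsman topology: for a metric space $(X,d)$, let $\mathcal F^*(X)$ be the set of non-empty closed subsets of $X$; the Wijsman topology on $\mathcal F^*(X)$ is the coarsest topology making $F\mapsto d(x,F)$ continuous for every $x\in X$. The set $\mathcal G_{\|\cdot\|}(E)\subseteq \mathcal F^*(E)$ carries the topology induced by the Wijsman topology associated to the metric $d(u,v)=\|u-v\|$. Vietoris topology: for a compact Hausdorff space $X$, the Vietoris topology on the set $\mathcal F(X)$ of closed subsets of $X$ is generated by the sets $\{F: F\cap U\neq\emptyset\}$ and $\{F: F\subseteq U\}$ for $U\subseteq X$ open. The closed unit ball $(E^* )_1$ of $E^*$ (for the dual norm) is compact Hausdorff for the weak-$*$ topology. A subspace $W\in\mathcal G_{w*}(E^* )$ is identified with its closed unit ball $(W)_1=W\cap (E^* )_1\in\mathcal F((E^* )_1)$, and $\mathcal G_{w*}(E^* )$ carries the topology induced by the Vietoris topology of $\mathcal F((E^* )_1)$. *)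

(* Defs.v *)
From HB Require Import structures.
From mathcomp Require Import all_boot all_order all_algebra.
From mathcomp Require Import all_classical all_reals all_analysis.
From mathcomp Require Import complex.

Set Implicit Arguments.
Unset Strict Implicit.
Unset Printing Implicit Defensive.

Import Order.TTheory GRing.Theory Num.Theory.
Import numFieldNormedType.Exports.

Local Open Scope classical_set_scope.
Local Open Scope ring_scope.

Definition homeomorphism (X Y : topologicalType) (f : X -> Y) : Prop :=
  exists g : Y -> X, [/\ cancel f g, cancel g f, continuous f & continuous g].

(* Coarsest topology on S making every f i continuous. *)
Definition initial_family (S I : Type) (T : I -> Type) (f : forall i, S -> T i)
  : Type := S.

HB.instance Definition _ (S : choiceType) (I : Type) (T : I -> topologicalType)
    (f : forall i, S -> T i) :=
  Topological.copy (initial_family f)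
    (sup_topology (fun i => Topological.class (initial_topology (f i)))).

Lemma initial_family_continuous (S : choiceType) (I : Type)
    (T : I -> topologicalType) (f : forall i, S -> T i) (i : I) :
  continuous (f i : initial_family f -> T i).
Proof.
move=> x A /(@initial_continuous _ _ (f i)) nA.
by have /cvg_sup/(_ i)/(_ (f i @^-1` A) nA) :=
  @cvg_id _ (nbhs (x : initial_family f)).
Qed.

Section Wijsman.
Variables (R : realType) (X : topologicalType).

(* F^*(X).  The function d is meant to be a distance inducing the topology of
   X; it occurs here so that the topology below can be attached to it. *)
Definition wijsman (d : X -> X -> R) : Type :=
  set_type [set F : set X | F !=set0 /\ closed F].

Variable d : X -> X -> R.

HB.instance Definition _ := Choice.on (wijsman d).

Definition dist_set (x : X) (F : set X) : R := inf [set d x y | y in F].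

Definition wijsman_dist (x : X) (F : wijsman d) : R := dist_set x (\val F).

HB.instance Definition _ :=
  Topological.copy (wijsman d) (initial_family wijsman_dist).

End Wijsman.

Section Vietoris.
Variable X : topologicalType.

Definition vietoris : Type := set_type [set F : set X | closed F].

HB.instance Definition _ := Choice.on vietoris.

Definition vietoris_hit (U : set X) : set vietoris :=
  [set F : vietoris | \val F `&` U !=set0].

Definition vietoris_in (U : set X) : set vietoris :=
  [set F : vietoris | \val F `<=` U].

Definition vietoris_subbase : set (set vietoris) :=
  [set vietoris_hit U | U in open] `|` [set vietoris_in U | U in open].

HB.instance Definition _ :=
  isSubBaseTopological.Build vietoris vietoris_subbase id.

End Vietoris.

Section Dual.
Variables (R : realType) (E : normedModType R[i]).

(* The library norm takes values in R[i]; this is the same number in R. *)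
Definition rnorm (x : E) : R := complex.Re `|x|.

Definition continuous_functional : {pred (E -> R[i]^o)} :=
  [in [set f : E -> R[i]^o | linear f /\ continuous f]].

Lemma continuous_functional_submod_closed :
  submod_closed continuous_functional.
Proof.
split=> [|a f g]; rewrite !inE.
  split=> [a x y|x]; last exact: cvg_cst.
  by rewrite [LHS]/(0 : R[i]) scaler0 add0r.
move=> [lf cf] [lg cg]; split=> [b x y|x].
  rewrite -[LHS]/(a *: f (b *: x + y) + g (b *: x + y)) lf lg.
  rewrite -[(a *: f + g) x]/(a *: f x + g x) -[(a *: f + g) y]/(a *: f y + g y).
  by rewrite !scalerDr !scalerA mulrC addrACA.
by apply: cvgD; [apply: cvgZr; exact: cf | exact: cg].
Qed.

HB.instance Definition _ := GRing.isSubmodClosed.Build R[i] (E -> R[i]^o)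
  continuous_functional continuous_functional_submod_closed.

Definition dual : Type := {f : E -> R[i]^o | f \in continuous_functional}.

HB.instance Definition _ := SubChoice.on dual.
HB.instance Definition _ := [SubChoice_isSubLmodule of dual by <:].

Definition dual_eval (x : E) (w : dual) : R[i]^o := \val w x.

(* As a topological space, dual carries the weak-* topology. *)
HB.instance Definition _ := Topological.copy dual (initial_family dual_eval).

Definition dual_norm (w : dual) : R :=
  sup [set complex.Re `|dual_eval x w| | x in [set x | rnorm x <= 1]].

Definition dual_ball : set dual := [set w | dual_norm w <= 1].

End Dual.

Arguments dual_ball {R} E.

Section Grassmannians.
Variables (R : realType) (E : normedModType R[i]).

Definition Gnorm : Type :=
  set_type [set V : set E | closed V /\ submod_closed [in V]].

HB.instance Definition _ := Choice.on Gnorm.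

Definition norm_dist (u v : E) : R := rnorm (u - v).

Lemma Gnorm_wijsman_subproof (V : Gnorm) :
  \val V \in [set F : set E | F !=set0 /\ closed F].
Proof.
have [clV [V0 _]] := set_valP V.
by rewrite inE; split=> //; exists 0; exact: set_mem.
Qed.

Definition Gnorm_wijsman (V : Gnorm) : wijsman norm_dist :=
  exist _ (\val V) (Gnorm_wijsman_subproof V).

HB.instance Definition _ :=
  Topological.copy Gnorm (initial_topology Gnorm_wijsman).

Definition Gweak : Type :=
  set_type [set W : set (dual E) | closed W /\ submod_closed [in W]].

HB.instance Definition _ := Choice.on Gweak.

Lemma Gweak_ball_subproof (W : Gweak) :
  (set_val : dual_ball E -> dual E) @^-1` (\val W)
    \in [set F : set (dual_ball E) | closed F].
Proof.
have [clW _] := set_valP W; rewrite inE.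
by apply: (preimage_closed _ clW) => x _; exact: initial_continuous.
Qed.

(* W |-> (W)_1, seen as a closed subset of the space (E^* )_1. *)
Definition Gweak_ball (W : Gweak) : vietoris (dual_ball E) :=
  exist _ ((set_val : dual_ball E -> dual E) @^-1` (\val W))
    (Gweak_ball_subproof W).

HB.instance Definition _ :=
  Topological.copy Gweak (initial_topology Gweak_ball).

Definition annihilator (V : set E) : set (dual E) :=
  [set w | forall x, V x -> dual_eval x w = 0].

Lemma dual_eval_continuous (x : E) : continuous (@dual_eval R E x).
Proof. exact: initial_family_continuous. Qed.

Lemma annihilator_subproof (V : set E) :
  annihilator V \in
    [set W : set (dual E) | closed W /\ submod_closed [in W]].
Proof.
rewrite inE; split; last first.
  split=> [|a f g]; first by rewrite inE.
  rewrite !inE => fV gV x Vx.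
  rewrite -[LHS]/(a *: dual_eval x f + dual_eval x g).
  by rewrite (fV x Vx) (gV x Vx) scaler0 addr0.
have -> : annihilator V =
    \bigcap_(x in V) (dual_eval x @^-1` [set (0 : R[i]^o)]).
  by apply/seteqP; split=> w.
apply: closed_bigI => x _; apply: preimage_closed.
  by move=> w _; exact: dual_eval_continuous.
exact/accessible_closed_set1/hausdorff_accessible/norm_hausdorff.
Qed.

Definition Phi (V : Gnorm) : Gweak :=
  exist _ (annihilator (\val V)) (annihilator_subproof (\val V)).

End Grassmannians.

(* Main.v *)
From HB Require Import structures.
Require Import Defs.
From mathcomp Require Import all_boot all_order all_algebra.
From mathcomp Require Import all_classical all_reals all_analysis.
From mathcomp Require Import complex ring lra.
Import numFieldNormedType.Exports.

Set Implicit Arguments.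
Unset Strict Implicit.
Unset Printing Implicit Defensive.

Import Order.TTheory GRing.Theory Num.Theory.

Local Open Scope classical_set_scope.
Local Open Scope ring_scope.

(** The whole argument rests on the duality between distances and annihilators.
If [V] is a subspace of [E], then [d(x, V)] is the maximum of [|w x|] over the
functionals [w] of norm at most one that vanish on [V] ([annihilator_le_dist],
[dist_attained]); this is the Hahn-Banach theorem for the seminorm
[d(-, V)].  Thus the Wijsman topology records exactly the support functions of
the balls of the annihilators.

Bijectivity.  A closed [V] is recovered from its annihilator by this formula,
since [x] lies in [V] as soon as [d(x, V) = 0] ([bipolar_norm]).  A weak-*
closed [W] is the annihilator of its preannihilator by linear algebra alone: a
weak-* neighbourhood tests only finitely many vectors, and on finitely many
vectors a functional that vanishes on the preannihilator of [W] agrees with an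
element of [W] ([preannihilator_interpolation], [bipolar_weak_star]).

Continuity of the inverse.  The condition [d(x, V) > a] holds iff the ball of
the annihilator hits the open set of the [w] with [Re (w x) > a], and
[d(x, V) < b] follows if this ball is contained in the set where
[Re (w x) < b].

Continuity of [Phi].  For the condition of being contained in an open set, the
unit ball is weak-* compact ([dual_ball_compact]): a functional [w] outside the
annihilator of [V] has [w x <> 0] for some [x] in [V], and the neighbouring
functionals cannot annihilate a [V'] with [d(x, V')] small.
For the condition of hitting an open set, let [w] be in the ball of the
annihilator of [V], and let finitely many vectors and a tolerance [e] be given.
On the real span of these vectors, [d(-, V)] is at most [d(-, V')] up to a small
multiple of the size of the coefficients, for all [V'] near [V]: by
homogeneity the coefficients can be taken in the unit cube, which is compact
([dist_near_uniform]).  A version of the Hahn-Banach theorem with prescribed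
upper bounds on a convex cone ([hahn_banach_cone]) then produces a functional
dominated by [d(-, V')], hence in the ball of the annihilator of [V'], that is
[e]-close to [w] on these vectors ([annihilator_approximation]). *)

(** * The Hahn-Banach theorem with constraints on a convex cone *)

Section HahnBanach.
Variables (R : realType) (V : lmodType R).
Implicit Types (p q : V -> R) (S : set (V * R)).

Definition sublinear p :=
  (forall x y, p (x + y) <= p x + p y) /\
  (forall t x, 0 <= t -> p (t *: x) <= t * p x).

Definition convex_cone S :=
  [/\ S (0, 0),
      forall a b, S a -> S b -> S (a.1 + b.1, a.2 + b.2) &
      forall t a, 0 <= t -> S a -> S (t *: a.1, t * a.2)].

Lemma sublinear0 p : sublinear p -> p 0 = 0.
Proof.
move=> [pD pZ]; apply/eqP; rewrite eq_le.
have := pZ 0 0 (lexx _); have := pD 0 0; rewrite addr0 scaler0 mul0r => h ->/=.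
by rewrite -(lerD2l (p 0)) addr0.
Qed.

Lemma sublinear_ge p x : sublinear p -> - p (- x) <= p x.
Proof.
move=> sp; have := sp.1 x (- x); rewrite subrr (sublinear0 sp); lra.
Qed.

Lemma sublinearZ p t x : sublinear p -> 0 <= t -> p (t *: x) = t * p x.
Proof.
move=> sp; rewrite le_eqVlt => /predU1P[<-|t0].
  by rewrite scale0r mul0r sublinear0.
apply/eqP; rewrite eq_le (sp.2 _ _ (ltW t0)) /=.
have := sp.2 t^-1 (t *: x); rewrite invr_ge0 (ltW t0) => /(_ isT).
by rewrite scalerA mulVf ?gt_eqF// scale1r ler_pdivlMl.
Qed.

(** The functional is the infimal convolution of [p] with the constraints,
[x |-> inf { p (x - a) + s | (a, s) in S }]; the hypothesis on [S] bounds the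
set of these numbers below by [0] at [x = 0], and hence by [- p (- x)] at every
[x]. *)
Lemma sublinear_below_cone p S : sublinear p -> convex_cone S ->
  (forall a, S a -> - a.2 <= p (- a.1)) ->
  exists q, [/\ sublinear q, (forall x, q x <= p x) &
    (forall a, S a -> q a.1 <= a.2)].
Proof.
move=> sp [S0 SD SZ] Sp.
pose A x := [set p (x - a.1) + a.2 | a in S].
have Alb x : has_lbound (A x).
  exists (- p (- x)) => _ [a Sa <-].
  have := sp.1 (- x) (x - a.1); rewrite addKr; have := Sp _ Sa; lra.
have Aneq x : A x !=set0 by exists (p (x - 0) + 0), (0, 0).
have Ale x a : S a -> inf (A x) <= p (x - a.1) + a.2.
  by move=> Sa; apply: ge_inf => //; exists a.
exists (fun x => inf (A x)); split => [|x|a Sa].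
- split=> [x y|t x t0].
    rewrite -lerBlDr; apply: lb_le_inf => // _ [a Sa <-].
    rewrite lerBlDl -lerBlDr; apply: lb_le_inf => // _ [b Sb <-].
    rewrite lerBlDr; apply: le_trans (Ale _ _ (SD _ _ Sa Sb)) _ => /=.
    have := sp.1 (x - a.1) (y - b.1).
    by rewrite addrACA -opprD; lra.
  have Atx a : S a -> inf (A (t *: x)) <= t * (p (x - a.1) + a.2).
    move=> Sa; apply: le_trans (Ale _ _ (SZ _ _ t0 Sa)) _ => /=.
    by rewrite -scalerBr mulrDr lerD2r; exact: sp.2.
  move: t0; rewrite le_eqVlt => /predU1P[t0|t0].
    by have := Atx _ S0; rewrite -t0 !mul0r.
  rewrite /= -ler_pdivrMl//; apply: lb_le_inf => // _ [a Sa <-].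
  by rewrite ler_pdivrMl//; exact: Atx.
- by have := Ale x _ S0; rewrite subr0 addr0.
- by have := Ale a.1 _ Sa; rewrite subrr (sublinear0 sp) add0r.
Qed.

(** Zorn's lemma applies because the pointwise infimum of a chain of sublinear
functionals is sublinear, being bounded below by [- p (- x)] at [x]. *)
Lemma minimal_sublinear_exists p : sublinear p ->
  exists q, [/\ sublinear q, (forall x, q x <= p x) &
    forall r, sublinear r -> (forall x, r x <= q x) -> r = q].
Proof.
move=> sp.
pose T := {q : V -> R | sublinear q /\ forall x, q x <= p x}.
pose ge (q r : T) := `[< forall x, sval r x <= sval q x >].
have [| | |A totA|[q [sq qp]] qmin] := @Zorn T ge.
- by move=> q; apply/asboolP.
- move=> q r s /asboolP qr /asboolP rs; apply/asboolP => x.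
  exact: le_trans (rs x) (qr x).
- move=> [q hq] [r hr] /asboolP qr /asboolP rq.
  by apply: eq_exist; apply/funext => x; apply/le_anti; rewrite (qr x) (rq x).
- have [->|/set0P[q0 Aq0]] := eqVneq A set0.
    by exists (exist _ p (conj sp (fun x => lexx _))).
  pose B x := [set sval q x | q in A].
  have Bneq x : B x !=set0 by exists (sval q0 x), q0.
  have Blb x : has_lbound (B x).
    exists (- p (- x)) => _ [[q [sq qp]] Aq <-] /=.
    by apply: le_trans (sublinear_ge x sq); rewrite lerN2.
  have Ble (q : T) x : A q -> inf (B x) <= sval q x.
    by move=> Aq; apply: ge_inf => //; exists q.
  have sB : sublinear (fun x => inf (B x)).
    split=> [x y|t x t0].
      rewrite -lerBlDr; apply: lb_le_inf => // _ [r Ar <-].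
      rewrite lerBlDl -lerBlDr; apply: lb_le_inf => // _ [q Aq <-].
      rewrite lerBlDr; have [/asboolP qr|/asboolP rq] := totA _ _ Aq Ar.
        (* The smaller of [q] and [r] serves at both points. *)
        apply: le_trans (Ble _ _ Ar) _; apply: le_trans ((svalP r).1.1 _ _) _.
        by rewrite addrC lerD.
      apply: le_trans (Ble _ _ Aq) _; apply: le_trans ((svalP q).1.1 _ _) _.
      by rewrite addrC lerD.
    have Btx (q : T) : A q -> inf (B (t *: x)) <= t * sval q x.
      by move=> /Ble/le_trans; apply; exact: (svalP q).1.2.
    move: t0; rewrite le_eqVlt => /predU1P[t0|t0].
      by have := Btx _ Aq0; rewrite -t0 !mul0r.
    rewrite -ler_pdivrMl//; apply: lb_le_inf => // _ [q Aq <-].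
    by rewrite ler_pdivrMl//; exact: Btx.
  have Bp x : inf (B x) <= p x.
    by apply: le_trans (Ble _ _ Aq0) _; exact: (svalP q0).2.
  exists (exist _ (fun x => inf (B x)) (conj sB Bp)) => q Aq.
  by apply/asboolP => x; exact: Ble.
- exists q; split=> // r sr rq.
  have rp x : r x <= p x by exact: le_trans (rq x) (qp x).
  by have [] := qmin (exist _ r (conj sr rp)) (asboolT rq).
Qed.

(** If [q] is minimal, then imposing the bound [- q a] at [- a] on it, which
[sublinear_below_cone] permits, cannot change it; so [q (- a) = - q a], and an
odd sublinear functional is linear. *)
Lemma minimal_sublinear_linear q : sublinear q ->
  (forall r, sublinear r -> (forall x, r x <= q x) -> r = q) -> scalar q.
Proof.
move=> sq qmin.
have qN a : q (- a) = - q a.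
  apply/eqP; rewrite eq_le lerNl (sublinear_ge _ sq) andbT.
  pose S := [set b : V * R | exists2 t, 0 <= t & b = (- (t *: a), - (t * q a))].
  have [| |r [sr rq rS]] := @sublinear_below_cone q S sq.
  - split=> [|_ _ [t t0 ->] [u u0 ->]|t _ t0 [u u0 ->]] /=.
    + by exists 0; rewrite // scale0r mul0r !oppr0.
    + exists (t + u); first exact: addr_ge0.
      by rewrite scalerDl mulrDl !opprD.
    + by exists (t * u); rewrite ?mulr_ge0// -scalerA -mulrA scalerN mulrN.
  - by move=> _ [t t0 ->] /=; rewrite !opprK sublinearZ.
  have := rS (- a, - q a); rewrite (qmin r)//; apply.
  by exists 1; rewrite // scale1r mul1r.
have qZ t x : q (t *: x) = t * q x.
  have [t0|t0] := leP 0 t; first exact: sublinearZ.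
  apply: oppr_inj; rewrite -mulNr -sublinearZ ?oppr_ge0 ?ltW// -qN.
  by rewrite scaleNr.
move=> t x y; apply/eqP; rewrite eq_le -qZ sq.1 /=.
rewrite -lerN2 opprD -!qN opprD; exact: sq.1.
Qed.

(** The usual theorem is the case of the cone of the pairs [(- t x, - t (p x))],
with [t] nonnegative, for which [f x = p x]. *)
Lemma hahn_banach_cone p S : sublinear p -> convex_cone S ->
  (forall a, S a -> - a.2 <= p (- a.1)) ->
  exists f : {scalar V}, (forall x, f x <= p x) /\
    forall a, S a -> f a.1 <= a.2.
Proof.
move=> sp cS Sp; have [q [sq qp qS]] := sublinear_below_cone sp cS Sp.
have [r [sr rq rmin]] := minimal_sublinear_exists sq.
have lr := minimal_sublinear_linear sr rmin.
pose fM := GRing.isLinear.Build R V R *%R r lr.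
pose f : {scalar V} := HB.pack r fM.
exists f; split=> [x|a Sa]; first exact: le_trans (rq x) (qp x).
exact: le_trans (rq _) (qS _ Sa).
Qed.

End HahnBanach.

(** * Complex functionals and their real parts *)

Section RestrictionOfScalars.
Variables (R : realType) (E : lmodType R[i]).

(** [E] as a real vector space; a separate name is needed for the second module
structure. *)
Definition realify : Type := E.

HB.instance Definition _ := GRing.Zmodule.on realify.

Definition real_scale (t : R) (x : realify) : realify := (t%:C)%C *: (x : E).

Fact real_scaleA a b x : real_scale a (real_scale b x) = real_scale (a * b) x.
Proof. by rewrite /real_scale scalerA -rmorphM. Qed.

Fact real_scale1 : left_id 1 real_scale.
Proof. by move=> x; rewrite /real_scale scale1r. Qed.

Fact real_scaleDr : right_distributive real_scale +%R.
Proof. by move=> t x y; exact: scalerDr. Qed.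

Fact real_scaleDl x : {morph real_scale^~ x : a b / a + b}.
Proof. by move=> a b; rewrite /real_scale rmorphD scalerDl. Qed.

HB.instance Definition _ := GRing.Zmodule_isLmodule.Build R realify
  real_scaleA real_scale1 real_scaleDr real_scaleDl.

(** The only complex-linear functional that can have real part [f], because
[Im z] is [- Re (i z)]. *)
Definition complexify (f : realify -> R) (x : E) : R[i]^o :=
  (f x +i* - f ('i%C *: x))%C.

Lemma complexify_linear (f : {scalar realify}) : linear (complexify f).
Proof.
have fD (x y : E) : f (x + y) = f x + f y by exact: linearD.
have fZ (a : R[i]) (x : E) :
    f (a *: x) = complex.Re a * f x + complex.Im a * f ('i%C *: x).
  rewrite {1}[a]complexE scalerDl [_ * (_ %:C)%C]mulrC -scalerA fD.
  have fr t (y : E) : f ((t%:C)%C *: y) = t * f y.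
    exact: (linearZ_LR f t (y : realify)).
  by rewrite !fr.
move=> a x y; rewrite /complexify [_ *: (_ + y)]scalerDr [_ *: (a *: x)]scalerA.
rewrite (fD (a *: x)) (fD (_ *: x) (_ *: y)) (fZ a) (fZ (_ * a)).
by case: a => a b /=; apply/eqP; rewrite eq_complex /=; apply/andP; split;
  apply/eqP; ring.
Qed.

End RestrictionOfScalars.

Section RealNorm.
Variables (R : realType).
Implicit Types (E : normedModType R[i]).

Lemma rnormE E (x : E) : `|x| = ((rnorm x)%:C)%C.
Proof. by rewrite RRe_real// normr_real. Qed.

Lemma rnorm_ge0 E (x : E) : 0 <= rnorm x.
Proof. by rewrite -ler0c -rnormE. Qed.

Lemma rnorm0 E : rnorm (0 : E) = 0.
Proof. by rewrite /rnorm normr0. Qed.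

Lemma rnorm_eq0 E (x : E) : rnorm x = 0 -> x = 0.
Proof. by move=> x0; apply/normr0_eq0; rewrite rnormE x0. Qed.

Lemma rnormB E (x y : E) : rnorm (x - y) = rnorm (y - x).
Proof. by rewrite /rnorm distrC. Qed.

Lemma rnormD E (x y : E) : rnorm (x + y) <= rnorm x + rnorm y.
Proof. by rewrite -lecR rmorphD /= -!rnormE; exact: ler_normD. Qed.

Lemma rnormZ E (c : R[i]) (x : E) :
  rnorm (c *: x) = rnorm (c : R[i]^o) * rnorm x.
Proof. by apply: complexI; rewrite rmorphM /= -!rnormE normrZ. Qed.

Lemma rnorm_real (t : R) : rnorm ((t%:C)%C : R[i]^o) = `|t|.
Proof. by rewrite /rnorm normc_def /= expr0n addr0 sqrtr_sqr. Qed.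

Lemma rnorm_ge_Re (z : R[i]^o) : `|complex.Re z| <= rnorm z.
Proof. by rewrite -lecR -rnormE; exact: normc_ge_Re. Qed.

Lemma rnorm_le_ReIm (z : R[i]^o) :
  rnorm z <= `|complex.Re z| + `|complex.Im z|.
Proof.
rewrite [z in leLHS]complexE; apply: le_trans (rnormD _ _) _.
rewrite rnorm_real lerD2l mulrC.
rewrite -[X in rnorm X]/(_ *: ('i%C : R[i]^o)) rnormZ rnorm_real.
by rewrite /rnorm normc_def /= expr0n expr1n add0r sqrtr1 mulr1.
Qed.

Lemma Re_conjM (z : R[i]) :
  rnorm (z : R[i]^o) * rnorm (z : R[i]^o) <= complex.Re (z^*%C * z).
Proof.
case: z => a b /=; rewrite /rnorm normc_def /= -expr2 sqr_sqrtr.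
  by rewrite mulNr opprK -!expr2.
by rewrite addr_ge0 ?sqr_ge0.
Qed.

(** A bound on the real part of [w] by a seminorm bounds [w] itself: apply it to
the multiple of [x] by the conjugate of [w x], where [w] is real. *)
Lemma Re_bound_norm E (w : E -> R[i]^o) (p : E -> R) : linear w ->
  (forall (c : R[i]) x, p (c *: x) <= rnorm (c : R[i]^o) * p x) ->
  (forall x, complex.Re (w x) <= p x) -> forall x, rnorm (w x) <= p x.
Proof.
move=> lw pZ wp x.
have wZ c y : w (c *: y) = c *: w y.
  pose m := GRing.isLinear.Build R[i] E R[i]^o *:%R w lw.
  pose W : {linear E -> R[i]^o} := HB.pack w m.
  exact: (linearZ_LR W).
have [wx0|wx0] := eqVneq (w x) 0.
  by have := wp x; rewrite wx0 rnorm0.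
have nwx : 0 < rnorm (w x).
  by rewrite lt_def rnorm_ge0 andbT; apply: contra_neq wx0 => /rnorm_eq0.
rewrite -(ler_pM2l nwx); have := pZ ((w x)^*)%C x.
have -> : rnorm ((w x)^*%C : R[i]^o) = rnorm (w x) by rewrite /rnorm normcJ.
apply: le_trans; apply: le_trans (wp _); rewrite wZ.
exact: Re_conjM.
Qed.

End RealNorm.

(** * The unit ball of the dual *)

Section DualSpace.
Variables (R : realType) (E : normedModType R[i]).
Implicit Types (w : dual E) (x y : E).

Lemma dual_linear w : linear ((fun x => dual_eval x w) : E -> R[i]^o).
Proof. by have := valP w; rewrite inE => -[]. Qed.

Lemma dual_continuous w : continuous ((fun x => dual_eval x w) : E -> R[i]^o).
Proof. by have := valP w; rewrite inE => -[]. Qed.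

Lemma dual_linear_bundle w :
  exists f : {linear E -> R[i]^o}, forall x, f x = dual_eval x w.
Proof.
pose f : E -> R[i]^o := fun x => dual_eval x w.
pose m := GRing.isLinear.Build R[i] E R[i]^o *:%R f (@dual_linear w).
by exists (HB.pack f m : {linear E -> R[i]^o}).
Qed.

Lemma dual_evalB w x y : dual_eval (x - y) w = dual_eval x w - dual_eval y w.
Proof. by have [f fw] := dual_linear_bundle w; rewrite -!fw linearB. Qed.

Lemma dual_evalD w x y : dual_eval (x + y) w = dual_eval x w + dual_eval y w.
Proof. by have [f fw] := dual_linear_bundle w; rewrite -!fw linearD. Qed.

Lemma dual_evalZ w (c : R[i]) x : dual_eval (c *: x) w = c *: dual_eval x w.
Proof. by have [f fw] := dual_linear_bundle w; rewrite -!fw linearZ_LR. Qed.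

Lemma dual_eval_comb (c : R[i]) w1 w2 x :
  dual_eval x (c *: w1 + w2) = c *: dual_eval x w1 + dual_eval x w2.
Proof. by []. Qed.

Lemma dual_bounded w :
  exists M, forall x, rnorm (dual_eval x w) <= M * rnorm x.
Proof.
have [f fw] := dual_linear_bundle w.
have cf : continuous f.
  rewrite (_ : (f : E -> R[i]^o) = (fun x => dual_eval x w)); last exact/funext.
  exact: dual_continuous.
have /linear_boundedP/pinfty_ex_gt0[r r0 fr] :=
  (linear_bounded_continuous f).2 cf.
exists (complex.Re r) => x; rewrite -fw -lecR rmorphM/= -!rnormE.
by rewrite RRe_real ?gtr0_real.
Qed.

(** The supremum that defines the dual norm would be [0] on an unbounded set, so
the direct implication needs the boundedness of continuous functionals. *)
Lemma dual_ballP w :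
  dual_ball E w <-> forall x, rnorm (dual_eval x w) <= rnorm x.
Proof.
split=> [w1 x|wle]; last first.
  apply: ge_sup; first by exists (rnorm (dual_eval 0 w)), 0; rewrite //= rnorm0.
  by move=> _ [x x1 <-]; exact: le_trans (wle x) x1.
have [M wM] := dual_bounded w.
have [->|x0] := eqVneq x 0.
  by apply: le_trans (wM _) _; rewrite rnorm0 mulr0.
have nx : 0 < rnorm x.
  by rewrite lt_def rnorm_ge0 andbT; apply: contra_neq x0 => /rnorm_eq0.
have nV : rnorm ((((rnorm x)^-1)%:C)%C : R[i]^o) = (rnorm x)^-1.
  by rewrite rnorm_real ger0_norm// invr_ge0 ltW.
rewrite -[leRHS]mulr1 -ler_pdivrMl//; apply: le_trans w1.
apply: ub_le_sup.
  exists (Num.max M 0) => _ [y y1 <-]; apply: le_trans (wM y) _.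
  apply: le_trans (_ : Num.max M 0 * rnorm y <= _).
    by rewrite ler_wpM2r ?rnorm_ge0// le_max lexx.
  by rewrite ler_piMr// le_max lexx orbT.
exists ((((rnorm x)^-1)%:C)%C *: x).
  by rewrite /= rnormZ nV mulVf ?gt_eqF.
by rewrite -[LHS]/(rnorm _) dual_evalZ rnormZ nV.
Qed.

Lemma dual_of_real_part (f : {scalar realify E}) : (forall x, f x <= rnorm x) ->
  exists2 w, dual_ball E w & forall x, complex.Re (dual_eval x w) = f x.
Proof.
move=> f1; have lF := complexify_linear f.
have Fle x : rnorm (complexify f x) <= rnorm x.
  by apply: Re_bound_norm => // c y; rewrite rnormZ.
pose g : E -> R[i]^o := complexify f.
pose m := GRing.isLinear.Build R[i] E R[i]^o *:%R g lF.
pose F : {linear E -> R[i]^o} := HB.pack g m.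
have cF : continuous F.
  apply/linear_bounded_continuous/bounded_funP => r; exists r => x.
  by apply: le_trans; rewrite !rnormE lecR; exact: Fle.
have Fin : complexify f \in @continuous_functional R E by rewrite inE.
exists (exist _ (complexify f) Fin) => //.
by apply/dual_ballP => x; exact: Fle.
Qed.

End DualSpace.

(** * The distance to a subspace *)

Section Distance.
Variables (R : realType) (E : normedModType R[i]) (V : set E).
Hypothesis smV : submod_closed [in V].
Local Notation dist x := (dist_set (@norm_dist R E) x V).

Let V0 : V 0.
Proof. exact/set_mem/smV.1. Qed.

Let VD a x y : V x -> V y -> V (a *: x + y).
Proof. by move=> Vx Vy; apply/set_mem/smV.2; exact/mem_set. Qed.

Lemma dist_le x v : V v -> dist x <= rnorm (x - v).
Proof.
move=> Vv; apply: ge_inf; last by exists v.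
by exists 0 => _ [y _ <-]; exact: rnorm_ge0.
Qed.

Lemma le_dist x c : (forall v, V v -> c <= rnorm (x - v)) -> c <= dist x.
Proof.
move=> h; apply: lb_le_inf; first by exists (norm_dist x 0), 0.
by move=> _ [v Vv <-]; exact: h.
Qed.

Lemma dist_ge0 x : 0 <= dist x.
Proof. by apply: le_dist => v _; exact: rnorm_ge0. Qed.

Lemma dist_le_rnorm x : dist x <= rnorm x.
Proof. by rewrite -[x in leRHS]subr0; exact: dist_le. Qed.

Lemma dist_mem x : V x -> dist x = 0.
Proof.
move=> Vx; apply/eqP; rewrite eq_le dist_ge0 andbT.
by apply: le_trans (dist_le _ Vx) _; rewrite subrr rnorm0.
Qed.

Lemma dist0 : dist 0 = 0.
Proof. exact: dist_mem V0. Qed.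

Lemma distD x y : dist (x + y) <= dist x + dist y.
Proof.
rewrite -lerBlDr; apply: le_dist => v Vv.
rewrite lerBlDl -lerBlDr; apply: le_dist => u Vu.
rewrite lerBlDl; have Vvu : V (v + u) by rewrite -[v]scale1r; exact: VD.
apply: le_trans (dist_le _ Vvu) _; rewrite opprD addrACA.
exact: rnormD.
Qed.

Lemma distZ (c : R[i]) x : dist (c *: x) <= rnorm (c : R[i]^o) * dist x.
Proof.
have Vc v : V v -> dist (c *: x) <= rnorm (c : R[i]^o) * rnorm (x - v).
  move=> Vv; have Vcv : V (c *: v) by rewrite -[_ *: _]addr0; exact: VD.
  by apply: le_trans (dist_le _ Vcv) _; rewrite -scalerBr rnormZ.
have [c0|c0] := eqVneq (rnorm (c : R[i]^o)) 0.
  by have := Vc _ V0; rewrite c0 !mul0r.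
have {}c0 : 0 < rnorm (c : R[i]^o) by rewrite lt_def c0 rnorm_ge0.
rewrite -ler_pdivrMl//; apply: le_dist => v Vv.
by rewrite ler_pdivrMl//; exact: Vc.
Qed.

Lemma dist_sublinear : sublinear (fun x : realify E => dist x).
Proof.
split=> [|t x t0]; first exact: distD.
by apply: le_trans (distZ _ _) _; rewrite rnorm_real ger0_norm.
Qed.

Lemma dist_lipschitz x y : dist x <= dist y + rnorm (x - y).
Proof.
rewrite -[x in dist x](subrK y) addrC; apply: le_trans (distD _ _) _.
by rewrite lerD2l dist_le_rnorm.
Qed.

Lemma dist_eq0 x : closed V -> dist x = 0 -> V x.
Proof.
move=> clV dx0; apply: clV => B /nbhs_ballP[e e0 eB].
have e0' : 0 < complex.Re e by move: e0; rewrite /= ltcE => /andP[].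
have [_ [v Vv <-] vlt] :
    exists2 r, [set norm_dist x y | y in V] r & r < complex.Re e.
  apply: inf_lt; first by exists (norm_dist x 0), 0.
  by rewrite -[inf _]/(dist x) dx0.
exists v; split=> //; apply: eB; rewrite -ball_normE /ball_/=.
by rewrite rnormE -[e]RRe_real ?gtr0_real// ltcR.
Qed.

Lemma annihilator_le_dist w x : annihilator V w -> dual_ball E w ->
  rnorm (dual_eval x w) <= dist x.
Proof.
move=> Vw /dual_ballP w1; apply: le_dist => v Vv.
by apply: le_trans (w1 _); rewrite dual_evalB (Vw _ Vv) subr0.
Qed.

(** Domination by the distance to [V] encodes both membership conditions: the
distance is at most the norm, and it vanishes on [V]. *)
Lemma annihilator_of_real_part (f : {scalar realify E}) :
  (forall x, f x <= dist x) ->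
  exists w, [/\ annihilator V w, dual_ball E w &
    forall x, complex.Re (dual_eval x w) = f x].
Proof.
move=> fle; have f1 x : f x <= rnorm x.
  exact: le_trans (fle x) (dist_le_rnorm x).
have [w w1 wf] := dual_of_real_part f1; exists w; split=> // x Vx.
apply: rnorm_eq0; apply/eqP; rewrite eq_le rnorm_ge0 andbT -(dist_mem Vx).
apply: (@Re_bound_norm _ _ _ (fun y => dist y) (dual_linear w)) => [|y].
  exact: distZ.
by rewrite wf.
Qed.

(** The cone forces [f (- x) <= - d(x, V)]. *)
Lemma dist_attained x : exists w, [/\ annihilator V w, dual_ball E w &
  complex.Re (dual_eval x w) = dist x].
Proof.
pose S := [set b : realify E * R |
  exists2 t, 0 <= t & b = (- (t *: (x : realify E)), - (t * dist x))].
have [| |f [fle fS]] := @hahn_banach_cone _ _ _ S dist_sublinear.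
- split=> [|_ _ [t t0 ->] [u u0 ->]|t _ t0 [u u0 ->]] /=.
  + by exists 0; rewrite // scale0r mul0r !oppr0.
  + exists (t + u); first exact: addr_ge0.
    by rewrite scalerDl mulrDl !opprD.
  + by exists (t * u); rewrite ?mulr_ge0// -scalerA -mulrA scalerN mulrN.
- move=> _ [t t0 ->] /=; rewrite !opprK.
  by rewrite (sublinearZ _ dist_sublinear).
have [w [Vw w1 wf]] := annihilator_of_real_part fle; exists w; split=> //.
rewrite wf; apply/eqP; rewrite eq_le fle/= -lerN2.
rewrite -(linearN f (x : realify E)).
apply: (fS (- (x : realify E), - dist x)).
by exists 1; rewrite // scale1r mul1r.
Qed.

End Distance.

(** * The weak-* topology *)

Section WeakStar.
Variables (R : realType) (E : normedModType R[i]).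
Implicit Types (w : dual E) (x y : E) (W : set (dual E)).

Lemma nonexpansive_continuous (g : R[i]^o -> R) :
  (forall a b, `|g a - g b| <= rnorm (a - b)) -> continuous g.
Proof.
move=> g1 a U /nbhs_ballP[e /= e0 eU].
apply/nbhs_ballP; exists (e%:C)%C => [|b]; first by rewrite /= ltcR.
rewrite -ball_normE /ball_/= rnormE ltcR => ab; apply: eU.
by rewrite -ball_normE /ball_/=; exact: le_lt_trans ab.
Qed.

Lemma Re_dual_eval_continuous y :
  continuous (fun w => complex.Re (dual_eval y w)).
Proof.
move=> w; apply: (@continuous_comp _ _ _ (@dual_eval R E y) (@complex.Re R)).
  exact: dual_eval_continuous.
apply: nonexpansive_continuous => a b.
rewrite (_ : complex.Re a - complex.Re b = complex.Re (a - b)).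
  exact: (@rnorm_ge_Re R (a - b)).
by case: a b => [? ?] [? ?].
Qed.

Lemma rnorm_dual_eval_continuous y :
  continuous (fun w => rnorm (dual_eval y w)).
Proof.
move=> w; apply: (@continuous_comp _ _ _ (@dual_eval R E y) (@rnorm R R[i]^o)).
  exact: dual_eval_continuous.
apply: nonexpansive_continuous => a b.
have le_add (c d : R[i]^o) : rnorm c <= rnorm (c - d) + rnorm d.
  by have := rnormD (c - d) d; rewrite subrK.
have := le_add a b; have := le_add b a; rewrite (rnormB b a) ler_norml.
by move=> h1 h2; apply/andP; split; lra.
Qed.

(** Real parts are enough because [Im (w x)] is [- Re (w (i x))]. *)
Lemma weak_star_nbhs w (U : set (dual E)) : nbhs w U ->
  exists (s : seq E) (e : R), 0 < e /\ forall w', (forall y, y \in s ->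
    `|complex.Re (dual_eval y w') - complex.Re (dual_eval y w)| < e) -> U w'.
Proof.
pose B (d : seq E * R) := [set w' | forall y, y \in d.1 ->
  `|complex.Re (dual_eval y w') - complex.Re (dual_eval y w)| < d.2].
pose F := filter_from [set d : seq E * R | 0 < d.2] B.
have FF : Filter F.
  apply: filter_from_filter; first by exists ([::], 1) => /=.
  move=> [s e] [s' e'] /= e0 e'0; exists (s ++ s', Num.min e e').
    by rewrite /= lt_min e0.
  move=> w' Bw'; split=> y /= ys.
    have := Bw' y; rewrite /= mem_cat ys => /(_ isT).
    by rewrite lt_min => /andP[].
  have := Bw' y; rewrite /= mem_cat ys orbT => /(_ isT).
  by rewrite lt_min => /andP[].
have Fw : F --> w.
  apply/cvg_sup => x A [_ [[P oP <-] /= Pw PA]].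
  have /nbhs_ballP [e e0 eP] : nbhs (dual_eval x w) P.
    exact: open_nbhs_nbhs.
  (* A positive element of [R[i]] is real; its real part is the radius. *)
  have e0' : 0 < complex.Re e by move: e0; rewrite /= ltcE => /andP[].
  exists ([:: x; 'i%C *: x], complex.Re e / 2); first by rewrite /= divr_gt0.
  move=> w' Bw'; apply: PA; apply: eP; rewrite -ball_normE /ball_/=.
  rewrite rnormE -[e]RRe_real ?gtr0_real// ltcR.
  have := Bw' x; rewrite /= inE eqxx => /(_ isT).
  have := Bw' ('i%C *: x); rewrite /= !inE eqxx orbT => /(_ isT).
  rewrite !dual_evalZ rnormB; move: (dual_eval x w) (dual_eval x w').
  case=> [a b] [c d] /=; rewrite /GRing.scale /= => h1 h2.
  apply: le_lt_trans (rnorm_le_ReIm _) _ => /=.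
  rewrite [ltRHS]splitr ltrD//.
  by move: h1; rewrite -normrN; congr (`|_| < _); ring.
by move=> /Fw [[s e] /= e0 BU]; exists s, e; split.
Qed.

Definition preannihilator W : set E :=
  [set x | forall w, W w -> dual_eval x w = 0].

(** Induction on [s].  If [y] is not in the preannihilator of [W], pick [u] in
[W] with [u y = 1]; the functional [w - (w y) u] vanishes on the preannihilator
of the subspace [W1] of the elements of [W] that vanish at [y], since
subtracting [(u x) y] from a vector [x] of that preannihilator gives a vector
of the preannihilator of [W]. *)
Lemma preannihilator_interpolation W w (s : seq E) : submod_closed [in W] ->
  (forall x, preannihilator W x -> dual_eval x w = 0) ->
  exists2 w', W w' & forall y, y \in s -> dual_eval y w' = dual_eval y w.
Proof.
elim: s W w => [|y s IHs] W w [/set_mem W0 WD'] Ww; first by exists 0.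
have WD (a : R[i]) u v : W u -> W v -> W (a *: u + v).
  by move=> Wu Wv; apply/set_mem/WD'; exact/mem_set.
have [Wy|] := pselect (preannihilator W y).
  have [w' Ww' w's] := IHs W w (conj (mem_set W0) WD') Ww.
  exists w' => // z; rewrite inE => /predU1P[->|/w's//].
  by rewrite (Wy _ Ww') (Ww _ Wy).
move=> /existsNP[u0 /not_implyP[Wu0 u0y]].
pose u := (dual_eval y u0)^-1 *: u0.
have Wu : W u by rewrite /u -[_ *: _]addr0; exact: WD.
have uy : dual_eval y u = 1.
  by rewrite /u -[_ *: _]addr0 dual_eval_comb addr0; exact/mulVf/eqP.
pose W1 := [set v | W v /\ dual_eval y v = 0].
have smW1 : submod_closed [in W1].
  split=> [|a f g]; first by rewrite inE.
  rewrite !inE => -[Wf fy] [Wg gy]; split; first exact: WD.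
  by rewrite dual_eval_comb fy gy scaler0 addr0.
pose c := dual_eval y w.
have W1w x : preannihilator W1 x -> dual_eval x ((- c) *: u + w) = 0.
  move=> W1x; rewrite dual_eval_comb.
  have Wx : preannihilator W (x - dual_eval x u *: y).
    move=> v Wv; rewrite dual_evalB dual_evalZ.
    have W1v : W1 ((- dual_eval y v) *: u + v).
      split; first exact: WD.
      by rewrite dual_eval_comb uy [_ *: _]mulr1 addNr.
    have := W1x _ W1v; rewrite dual_eval_comb => /eqP.
    rewrite scaleNr addrC subr_eq0 => /eqP ->.
    by rewrite -[X in X - _]/(_ * _) -[X in _ - X]/(_ * _) mulrC subrr.
  have := Ww _ Wx; rewrite dual_evalB dual_evalZ => /eqP.
  rewrite subr_eq0 => /eqP ->; rewrite scaleNr.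
  by rewrite -[X in _ + X]/(_ * _) -[X in - X + _]/(_ * _) mulrC addNr.
have [v [Wv vy] vs] := IHs W1 _ smW1 W1w.
exists (c *: u + v); first exact: WD.
move=> z; rewrite inE dual_eval_comb => /predU1P[->|/vs ->].
  by rewrite vy uy addr0 [LHS]mulr1.
by rewrite dual_eval_comb scaleNr addNKr.
Qed.

Lemma bipolar_weak_star W : closed W -> submod_closed [in W] ->
  annihilator (preannihilator W) = W.
Proof.
move=> clW smW; apply/seteqP; split=> [w Ww|w Ww x Wx]; last exact: Wx.
apply: clW => U /weak_star_nbhs[s [e [e0 sU]]].
have [w' Ww' w's] := preannihilator_interpolation s smW Ww.
by exists w'; split=> //; apply: sU => y /w's ->; rewrite subrr normr0.
Qed.

(** Banach-Alaoglu.  Along an ultrafilter on the ball the real parts at each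
vector converge, by compactness of segments; the limits form a real-linear
functional dominated by the norm, whose complexification is the limit. *)
Lemma dual_ball_compact : compact (@dual_ball R E).
Proof.
rewrite compact_ultra => F FU FB.
pose ev (x : E) w := complex.Re (dual_eval x w).
have lim_ex x : exists l : R, ev x @ F --> l.
  have : (ev x @ F) `[- rnorm x, rnorm x]%classic.
    apply: (@filterS _ F _ _ _ _ FB) => w /dual_ballP w1.
    rewrite /= in_itv/= -ler_norml.
    exact: (le_trans (rnorm_ge_Re (dual_eval x w)) (w1 x)).
  move=> /(@segment_compact R (- rnorm x) (rnorm x) (ev x @ F) _)[l [_ Fl]].
  exists l => U Ul; have [//|FCU] := in_ultra_setVsetC (ev x @^-1` U) FU.
  by have [z []] := Fl (~` U) U FCU Ul.
have [f fF] := choice lim_ex.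
have fE x (l : R) : ev x @ F --> l -> f x = l.
  by move=> Fl; exact: (cvg_unique _ (fF x) Fl).
have lf : scalar (f : realify E -> R).
  move=> t x y; apply: fE; rewrite (_ : ev _ = (fun w => t * ev x w + ev y w)).
    by apply: cvgD; [apply: cvgMl_tmp; exact: fF|exact: fF].
  apply/funext => w; rewrite /ev dual_evalD dual_evalZ.
  case: (dual_eval x w) (dual_eval y w) => a b [c d] /=.
  by rewrite /GRing.scale /= mul0r subr0.
pose m := GRing.isLinear.Build R (realify E) R *%R (f : realify E -> R) lf.
pose g : {scalar realify E} := HB.pack (f : realify E -> R) m.
have f1 x : f x <= rnorm x.
  apply: (closed_cvg _ (@closed_le R (rnorm x)) _ _ (fF x)).
  apply: (@filterS _ F _ _ _ _ FB) => w /dual_ballP w1.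
  apply: le_trans (ler_norm _) _.
  exact: (le_trans (rnorm_ge_Re (dual_eval x w)) (w1 x)).
have [w w1 wg] := @dual_of_real_part _ _ g f1.
exists w; split=> // U /weak_star_nbhs[s [e [e0 sU]]].
apply: filterS sU _; elim: s => [|y s IHs]; first exact: filterE.
have Fy : F [set w' | `|ev y w' - complex.Re (dual_eval y w)| < e].
  by rewrite wg; exact: (@cvgr_distC_lt _ _ _ F _ (ev y) (f y) (fF y)).
apply: (filterS _ (filterI Fy IHs)) => w' [yw' sw'] z.
by rewrite inE => /predU1P[->|/sw'].
Qed.

End WeakStar.

(** * Continuity for the Wijsman and Vietoris topologies *)

Section Topologies.

Lemma continuous_initial_family (T : topologicalType) (S : choiceType)
    (I : Type) (X : I -> topologicalType) (f : forall i, S -> X i)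
    (g : T -> initial_family f) :
  (forall i, continuous (fun t => f i (g t))) -> continuous g.
Proof.
move=> fg t; apply/cvg_sup => i A [_ [[P oP <-] /= Pgt PA]].
by apply: filterS PA _; exact: (fg i t _ (open_nbhs_nbhs (conj oP Pgt))).
Qed.

Lemma continuous_vietoris (T X : topologicalType) (f : T -> vietoris X) :
  (forall t U, open U -> vietoris_hit U (f t) ->
    \forall t' \near t, vietoris_hit U (f t')) ->
  (forall t U, open U -> vietoris_in U (f t) ->
    \forall t' \near t, vietoris_in U (f t')) ->
  continuous f.
Proof.
move=> fhit fin t A; rewrite nbhsE => -[_ [[B sB <-] [C BC Ct] BA]].
apply: (@filterS _ _ _ (f @^-1` C)); first by move=> s Cs; apply: BA; exists C.
have [D sD DC] := sB _ BC; rewrite -DC preimage_bigcap.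
apply: filter_bigI => P PD; have := sD _ PD; rewrite inE.
have Pt : P (f t) by move: Ct; rewrite -DC => /(_ _ PD).
by case=> -[U oU UP]; rewrite -UP in Pt *; [exact: fhit|exact: fin].
Qed.

Lemma open_vietoris_subbase (X : topologicalType) (A : set (vietoris X)) :
  vietoris_subbase A -> open A.
Proof.
move=> sA; exists [set A]; last by rewrite bigcup_set1.
move=> _ ->; exists (finmap.fset1 A); last by rewrite set_fset1 bigcap_set1.
by move=> B; rewrite finmap.in_fset1 inE => /eqP ->.
Qed.

Variables (R : realType) (E : normedModType R[i]).
Local Notation dist x V := (dist_set (@norm_dist R E) x (\val V)).

Lemma Gnorm_submod (V : Gnorm E) : submod_closed [in \val V].
Proof. by have [] := set_valP V. Qed.

Lemma Gnorm_dist_continuous x : continuous (fun V : Gnorm E => dist x V).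
Proof.
move=> V; apply: (@continuous_comp _ _ _ (@Gnorm_wijsman R E)
  (@wijsman_dist R E _ x)); first exact: initial_continuous.
exact: initial_family_continuous.
Qed.

Lemma continuous_Gnorm (T : topologicalType) (g : T -> Gnorm E) :
  (forall x, continuous (fun t => dist x (g t))) -> continuous g.
Proof.
by move=> cg; apply: continuous_comp_initial; exact: continuous_initial_family.
Qed.

(** The Vietoris topology lives on the ball as a space of its own; this
criterion and the two lemmas that follow express it by functionals on [E]. *)
Lemma continuous_Gweak (T : topologicalType) (f : T -> Gweak E) :
  (forall t U w, open U -> dual_ball E w -> \val (f t) w -> U w ->
    \forall t' \near t,
      exists w', [/\ dual_ball E w', \val (f t') w' & U w']) ->
  (forall t U, open U -> dual_ball E `&` \val (f t) `<=` U ->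
    \forall t' \near t, dual_ball E `&` \val (f t') `<=` U) ->
  continuous f.
Proof.
move=> fhit fin; apply: continuous_comp_initial; apply: continuous_vietoris.
  move=> t _ [U oU <-] [w [fw Uw]].
  apply: filterS (fhit t U (set_val w) oU (set_valP w) fw Uw).
  move=> t' [w' [w'1 fw' Uw']].
  by exists (exist _ w' (mem_set w'1)).
move=> t _ [U oU <-] fU; apply: filterS (fin t U oU _).
  by move=> t' fU' w fw; apply: fU'; split=> //; exact: set_valP.
by move=> w [w1 fw]; exact: (fU (exist _ w (mem_set w1))).
Qed.

Lemma Gweak_near_hit (W : Gweak E) U w : open U -> dual_ball E w -> \val W w ->
  U w -> \forall W' \near W, exists w', [/\ dual_ball E w', \val W' w' & U w'].
Proof.
move=> oU w1 Ww Uw.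
pose P := (set_val : dual_ball E -> dual E) @^-1` U.
have oP : open P by exists U.
have oH : open (vietoris_hit P) by apply: open_vietoris_subbase; left; exists P.
have WP : vietoris_hit P (Gweak_ball W) by exists (exist _ w (mem_set w1)).
have : \forall W' \near W, vietoris_hit P (Gweak_ball W').
  exact: (@initial_continuous _ _ (@Gweak_ball R E) W _
    (open_nbhs_nbhs (conj oH WP))).
apply: filterS => W'.
by move=> [w' [Ww' Uw']]; exists (set_val w'); split=> //; exact: set_valP.
Qed.

Lemma Gweak_near_in (W : Gweak E) U : open U -> dual_ball E `&` \val W `<=` U ->
  \forall W' \near W, dual_ball E `&` \val W' `<=` U.
Proof.
move=> oU WU; pose P := (set_val : dual_ball E -> dual E) @^-1` U.
have oP : open P by exists U.
have oI : open (vietoris_in P) by apply: open_vietoris_subbase; right; exists P.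
have WP : vietoris_in P (Gweak_ball W).
  by move=> w Ww; apply: WU; split=> //; exact: set_valP.
have : \forall W' \near W, vietoris_in P (Gweak_ball W').
  exact: (@initial_continuous _ _ (@Gweak_ball R E) W _
    (open_nbhs_nbhs (conj oI WP))).
apply: filterS => W'.
by move=> W'P w [w1 Ww]; exact: (W'P (exist _ w (mem_set w1))).
Qed.

End Topologies.

(** * Real linear combinations of finitely many vectors *)

Section FiniteCombinations.
Variables (R : realType) (E : normedModType R[i]) (s : seq E).
Local Notation n := (size s).

(** Real coefficients suffice, as real parts of values at finitely many vectors
describe the weak-* neighbourhoods. *)
Definition lincomb (t : 'rV[R]_n) : realify E :=
  \sum_(j < n) t 0 j *: (s`_j : realify E).

Lemma lincombD t u : lincomb (t + u) = lincomb t + lincomb u.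
Proof. by rewrite -big_split; apply: eq_bigr => j _; rewrite mxE scalerDl. Qed.

Lemma lincombZ (c : R) t : lincomb (c *: t) = c *: lincomb t.
Proof. by rewrite scaler_sumr; apply: eq_bigr => j _; rewrite mxE scalerA. Qed.

Lemma lincomb0 : lincomb 0 = 0.
Proof. by rewrite -(scale0r (0 : 'rV[R]_n)) lincombZ scale0r. Qed.

Lemma lincombN t : lincomb (- t) = - lincomb t.
Proof. by rewrite -scaleN1r lincombZ scaleN1r. Qed.

Lemma lincomb_delta j : lincomb (delta_mx 0 j) = s`_j.
Proof.
rewrite /lincomb (bigD1 j)//= big1 ?addr0 => [|k kj].
  by rewrite mxE !eqxx scale1r.
by rewrite mxE (negbTE kj) andbF scale0r.
Qed.

Lemma coord_le_norm (t : 'rV[R]_n) j : `|t 0 j| <= `|t|.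
Proof.
by rewrite [leRHS]/Num.norm /= mx_normrE; apply: (le_bigmax _ _ (0, j)).
Qed.

Lemma norm_delta_le1 j : `|delta_mx 0 j : 'rV[R]_n| <= 1.
Proof.
rewrite [leLHS]/Num.norm /= mx_normrE; apply: bigmax_le => // -[k l] _ /=.
by rewrite mxE normr_nat lern1 leq_b1.
Qed.

Lemma rnorm_lincomb t :
  rnorm (lincomb t : E) <= `|t| * \sum_(j < n) rnorm (s`_j).
Proof.
rewrite mulr_sumr /lincomb; elim/big_ind2: _ => [|a b c d ab cd|j _].
- by rewrite rnorm0.
- by apply: le_trans (rnormD _ _) _; exact: lerD.
- rewrite [leLHS]rnormZ rnorm_real.
  by rewrite ler_wpM2r ?rnorm_ge0// coord_le_norm.
Qed.

End FiniteCombinations.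

(** * Continuity of the annihilator map *)

Section PhiContinuous.
Variables (R : realType) (E : normedModType R[i]).
Local Notation dist x V := (dist_set (@norm_dist R E) x V).

(** The cone of the pairs [(x, r)], with [x] the combination of [s] with
coefficients [t] and [r >= Re (w x) + e |t|], forces the real part of the new
functional to be within [e] of that of [w] at the entries of [s], as [t] ranges
over the unit vectors and their opposites.  Its compatibility with [d(-, V')]
is the hypothesis on the two distances, because [Re (w x) <= d(x, V)]. *)
Lemma annihilator_approximation (V V' : set E) (s : seq E) (e : R) w :
  submod_closed [in V] -> submod_closed [in V'] ->
  (forall t, dist (lincomb t) V <= dist (@lincomb _ _ s t) V' + e * `|t|) ->
  0 <= e -> annihilator V w -> dual_ball E w ->
  exists w', [/\ dual_ball E w', annihilator V' w' & forall y, y \in s ->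
    `|complex.Re (dual_eval y w') - complex.Re (dual_eval y w)| <= e].
Proof.
move=> smV smV' VV' e0 Vw w1.
pose rw (x : realify E) := complex.Re (dual_eval (x : E) w).
have rwD x y : rw (x + y) = rw x + rw y.
  by rewrite /rw dual_evalD; case: (dual_eval _ _) (dual_eval _ _) => ? ? [].
have rwZ (c : R) x : rw (c *: x) = c * rw x.
  rewrite /rw dual_evalZ; case: (dual_eval _ _) => a b /=.
  by rewrite /GRing.scale /= mul0r subr0.
pose S := [set b : realify E * R | exists2 t, b.1 = @lincomb _ _ s t &
  rw (lincomb t) + e * `|t| <= b.2].
have [| |f [fle fS]] := @hahn_banach_cone _ _ _ S (dist_sublinear smV').
- split=> [|a b [t ta tr] [u ub uq]|c a c0 [t ta tr]].
  + exists 0; first by rewrite lincomb0.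
    rewrite /= lincomb0 -(scale0r (0 : realify E)) rwZ.
    by rewrite normr0 mul0r mulr0 addr0.
  + exists (t + u); first by rewrite /= ta ub lincombD.
    rewrite /= lincombD rwD; apply: le_trans (lerD tr uq).
    by rewrite addrACA lerD2l -mulrDr ler_wpM2l// ler_normD.
  + exists (c *: t); first by rewrite /= ta lincombZ.
    rewrite /= lincombZ rwZ normrZ ger0_norm// mulrCA -mulrDr.
    by rewrite ler_wpM2l.
- move=> a [t -> tr]; rewrite -lincombN.
  have le1 : rw (lincomb (- t)) <= dist (lincomb (- t)) V.
    apply: le_trans (annihilator_le_dist smV _ Vw w1).
    by apply: le_trans (ler_norm _) _; exact: rnorm_ge_Re.
  have := VV' (- t); rewrite normrN => le2.
  have rwN : rw (lincomb (- t)) = - rw (lincomb t).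
    by rewrite lincombN -scaleN1r rwZ mulN1r.
  by rewrite rwN in le1; lra.
have [w' [V'w' w'1 w'f]] := annihilator_of_real_part smV' fle.
exists w'; split=> // y /(nthP 0)[k ks <-]; rewrite w'f.
pose d : 'rV[R]_(size s) := delta_mx 0 (Ordinal ks).
have dy : lincomb d = s`_k by rewrite lincomb_delta.
have e1 : e * `|d| <= e by rewrite ler_piMr// norm_delta_le1.
have f1 : f s`_k <= rw s`_k + e.
  by apply: (fS (s`_k, _)); exists d; rewrite //= dy lerD2l.
have f2 : - f s`_k <= - rw s`_k + e.
  rewrite -(linearN f (s`_k : realify E)).
  apply: (fS (- (s`_k : realify E), _)); exists (- d).
    by rewrite lincombN dy.
  rewrite /= lincombN dy normrN -[- (s`_k : realify E)]scaleN1r rwZ mulN1r.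
  by rewrite lerD2l.
by rewrite ler_norml -/(rw _); apply/andP; split; lra.
Qed.

(** On the unit cube of coefficients the bound is a compactness argument, as
both distances are Lipschitz in the coefficients with the same constant; the
general case follows because both sides are positively homogeneous. *)
Lemma dist_near_uniform (V : Gnorm E) (s : seq E) (e : R) : 0 < e ->
  \forall V' \near V, forall t : 'rV[R]_(size s),
    dist (lincomb t) (\val V) <= dist (lincomb t) (\val V') + e * `|t|.
Proof.
move=> e0; pose K := [set t : 'rV[R]_(size s) | `|t| <= 1].
(* The summand [1] makes [M] positive even if all the vectors are zero. *)
pose M := 1 + \sum_(j < size s) rnorm (s`_j).
have M0 : 0 < M.
  by rewrite ltr_pwDl// sumr_ge0// => j _; exact: rnorm_ge0.
have cK : compact K.
  apply: bounded_closed_compact.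
    by exists 1; split=> // x x1 t /le_trans; apply; exact: ltW.
  apply: (@preimage_closed _ _ (fun t : 'rV[R]_(size s) => `|t|)
    [set r | r <= 1]).
    by move=> t _; exact: norm_continuous.
  exact: closed_le.
have near1 : \forall V' \near V, K `<=` (fun t =>
    dist (lincomb t) (\val V) <= dist (lincomb t) (\val V') + e).
  apply: ((compact_near_coveringP K).1 cK _ (nbhs V) (fun V' t =>
    dist (lincomb t) (\val V) <= dist (lincomb t) (\val V') + e) _) => t0 Kt0.
  have e3 : 0 < e / 3 by rewrite divr_gt0.
  have N1 : \forall t \near t0, `|t0 - t| < e / 3 / M.
    by have := nbhsx_ballx t0 _ (divr_gt0 e3 M0); rewrite -ball_normE.
  have N2 : \forall V' \near V, `|dist (lincomb t0) (\val V) -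
      dist (lincomb t0) (\val V')| < e / 3.
    exact: (@cvgr_dist_lt _ _ _ (nbhs V) _
      (fun V' : Gnorm E => dist (lincomb t0) (\val V')) _
      (@Gnorm_dist_continuous R E (lincomb t0) V)).
  exists ([set t | `|t0 - t| < e / 3 / M],
    [set V' : Gnorm E | `|dist (lincomb t0) (\val V) -
      dist (lincomb t0) (\val V')| < e / 3]) => //.
  move=> [t V'] [/= tt0 V'V].
  have d1 := dist_lipschitz (Gnorm_submod V) (lincomb t) (lincomb t0).
  have d2 := dist_lipschitz (Gnorm_submod V') (lincomb t0) (lincomb t).
  have d3 : rnorm (lincomb t0 - lincomb t : E) <= e / 3.
    rewrite -[X in rnorm X]/(lincomb t0 - lincomb t) -lincombN -lincombD.
    apply: le_trans (rnorm_lincomb _) _.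
    apply: (@le_trans _ _ (e / 3 / M * M)); last by rewrite divfK ?gt_eqF.
    by apply: ler_pM => //; [apply: sumr_ge0 => j _; exact: rnorm_ge0|
      exact: ltW|rewrite lerDr].
  have d4 : rnorm (lincomb t - lincomb t0 : E) <= e / 3 by rewrite rnormB.
  move: V'V; rewrite ltr_norml => /andP[_ V'V] /=; lra.
apply: filterS near1 => V' V'K t.
have [->|t0] := eqVneq t 0.
  by rewrite normr0 mulr0 addr0 lincomb0 !dist0 //; exact: Gnorm_submod.
have nt : 0 < `|t| by rewrite normr_gt0.
have := V'K (`|t|^-1 *: t).
rewrite /K /= normrZ normfV normr_id mulVf ?gt_eqF// => /(_ (lexx _)).
have distZ' (W : Gnorm E) (x : realify E) :
    dist (`|t|^-1 *: x) (\val W) = `|t|^-1 * dist x (\val W).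
  by rewrite (sublinearZ _ (dist_sublinear (Gnorm_submod W)))// invr_ge0.
rewrite lincombZ !distZ' -(ler_pM2l nt) mulrDr !mulrA divff ?gt_eqF// !mul1r.
by rewrite mulrC.
Qed.

Lemma Phi_continuous : continuous (@Phi R E).
Proof.
apply: continuous_Gweak => [V U w oU w1 Vw Uw|V U oU VU].
  have /weak_star_nbhs[s [e [e0 sU]]] : nbhs w U by exact: open_nbhs_nbhs.
  have e2 : 0 < e / 2 by rewrite divr_gt0.
  apply: filterS (dist_near_uniform V s e2) => V' VV'.
  have [w' [w'1 V'w' w's]] :=
    annihilator_approximation (Gnorm_submod V) (Gnorm_submod V') VV' (ltW e2)
      Vw w1.
  exists w'; split=> //; apply: sU => y /w's /le_lt_trans; apply.
  by rewrite ltr_pdivrMr// ltr_pMr// ltr1n.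
(* Each [w] of the ball has a neighbourhood that, for [V'] near [V], either lies
   in [U] or misses the annihilator of [V'] within the ball. *)
have := @dual_ball_compact R E => /compact_near_coveringP/near_covering_withinP.
move=> /(_ (Gnorm E) (nbhs V) (fun V' w => annihilator (\val V') w -> U w)).
have -> : (\forall V' \near V, dual_ball E `&` \val (Phi V') `<=` U) =
  \forall V' \near V,
    dual_ball E `<=` (fun w => annihilator (\val V') w -> U w).
  congr (nbhs V _); apply/funext => V'; apply/propext.
  by split=> [h w w1 V'w|h w [w1 V'w]]; [exact: h|exact: h].
apply=> w w1; have [Vw|] := pselect (annihilator (\val V) w).
  have Uw : nbhs w U by apply: open_nbhs_nbhs; split => //; exact: VU.
  by exists (U, setT) => [|[w' V'] []//]; split=> //; exact: filterT.
move=> /existsNP[x /not_implyP[Vx wx]].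
pose e := rnorm (dual_eval x w).
have e0 : 0 < e.
  by rewrite lt_def rnorm_ge0 andbT; apply: contra_notN wx => /eqP/rnorm_eq0.
have N1 : \forall w' \near w, e / 2 < rnorm (dual_eval x w').
  apply: (cvgr_gt _ (@rnorm_dual_eval_continuous R E x w)).
  by rewrite ltr_pdivrMr// ltr_pMr// ltr1n.
have N2 : \forall V' \near V, dist x (\val V') < e / 2.
  apply: (cvgr_lt _ (@Gnorm_dist_continuous R E x V)).
  by rewrite (dist_mem (Gnorm_submod V))// divr_gt0.
exists ([set w' | e / 2 < rnorm (dual_eval x w')],
  [set V' : Gnorm E | dist x (\val V') < e / 2]) => //.
move=> [w' V'] [/= lt1 lt2] w'1 V'w'.
have := annihilator_le_dist (Gnorm_submod V') x V'w' w'1.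
by rewrite leNgt (lt_trans lt2).
Qed.

End PhiContinuous.

(** * The inverse map *)

Section Inverse.
Variables (R : realType) (E : normedModType R[i]).
Local Notation dist x V := (dist_set (@norm_dist R E) x V).

Lemma preannihilator_subproof (W : set (dual E)) :
  preannihilator W \in [set V : set E | closed V /\ submod_closed [in V]].
Proof.
rewrite inE; split; last first.
  split=> [|a x y]; rewrite !inE.
    by move=> w _; rewrite -(subrr (0 : E)) dual_evalB subrr.
  move=> Wx Wy w Ww.
  by rewrite dual_evalD dual_evalZ (Wx _ Ww) (Wy _ Ww) scaler0 addr0.
have -> : preannihilator W =
    \bigcap_(w in W) ((fun x => dual_eval x w) @^-1` [set (0 : R[i]^o)]).
  by apply/seteqP; split=> x.
apply: closed_bigI => w _; apply: preimage_closed.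
  by move=> x _; exact: dual_continuous.
exact/accessible_closed_set1/hausdorff_accessible/norm_hausdorff.
Qed.

Definition preannihilator_map (W : Gweak E) : Gnorm E :=
  exist _ (preannihilator (\val W)) (preannihilator_subproof (\val W)).

Lemma bipolar_norm (V : set E) : closed V -> submod_closed [in V] ->
  preannihilator (annihilator V) = V.
Proof.
move=> clV smV; apply/seteqP; split=> [x Vx|x Vx w]; last exact.
apply: dist_eq0 => //; have [w [Vw _ <-]] := dist_attained smV x.
by rewrite (Vx w Vw).
Qed.

Lemma PhiK : cancel (@Phi R E) preannihilator_map.
Proof.
by move=> V; apply/val_inj; have [] := set_valP V; exact: bipolar_norm.
Qed.

Lemma preannihilator_mapK : cancel preannihilator_map (@Phi R E).
Proof.
by move=> W; apply/val_inj; have [] := set_valP W; exact: bipolar_weak_star.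
Qed.

Lemma preannihilator_map_continuous : continuous preannihilator_map.
Proof.
apply: continuous_Gnorm => x W.
set d := dist x (\val (preannihilator_map W)).
have annK (W' : Gweak E) : annihilator (\val (preannihilator_map W')) = \val W'.
  by rewrite -[in RHS](preannihilator_mapK W').
apply/(@cvgrPdist_lt _ _ _ (nbhs W) (nbhs_filter W)) => e e0.
have N1 : \forall W' \near W, d - e < dist x (\val (preannihilator_map W')).
  have [w [Ww w1 wx]] := dist_attained (Gnorm_submod (preannihilator_map W)) x.
  pose U := [set w' : dual E | d - e < complex.Re (dual_eval x w')].
  have oU : open U.
    apply: open_comp (@open_gt R (d - e)) => w' _.
    exact: Re_dual_eval_continuous.
  rewrite annK in Ww.
  have Uw : U w by rewrite /U /= wx ltrBlDr ltrDl.
  apply: filterS (Gweak_near_hit oU w1 Ww Uw) => W' [w' [w'1 W'w' /= ltw']].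
  apply: lt_le_trans ltw' _; apply: le_trans (ler_norm _) _.
  apply: le_trans (rnorm_ge_Re _) _.
  apply: (annihilator_le_dist (Gnorm_submod (preannihilator_map W'))) => //.
  by rewrite annK.
have N2 : \forall W' \near W, dist x (\val (preannihilator_map W')) < d + e.
  pose U := [set w' : dual E | complex.Re (dual_eval x w') < d + e].
  have oU : open U.
    apply: open_comp (@open_lt R (d + e)) => w' _.
    exact: Re_dual_eval_continuous.
  apply: filterS (Gweak_near_in oU _) => [W' W'U|w [w1 Ww]].
    have [w [W'w w1 <-]] :=
      dist_attained (Gnorm_submod (preannihilator_map W')) x.
    by apply: W'U; split=> //; rewrite -annK.
  apply: (@le_lt_trans _ _ d); last by rewrite ltrDl.
  apply: le_trans (ler_norm _) _; apply: le_trans (rnorm_ge_Re _) _.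
  apply: (annihilator_le_dist (Gnorm_submod (preannihilator_map W))) => //.
  by rewrite annK.
near=> W'.
have h1 : d - e < dist x (\val (preannihilator_map W')) by near: W'.
have h2 : dist x (\val (preannihilator_map W')) < d + e by near: W'.
by rewrite ltr_norml; apply/andP; split; lra.
Unshelve. all: by end_near. Qed.

End Inverse.

Theorem theorem4p10 (R : realType) (E : normedModType R[i]) :
  homeomorphism (@Phi R E).
Proof.
exists (@preannihilator_map R E); split; first exact: PhiK.
- exact: preannihilator_mapK.
- exact: Phi_continuous.
- exact: preannihilator_map_continuous.
Qed.
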